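(* Let $\phi^\circ_1,\dots,\phi^\circ_K$ be gaslighting efforts (probability density functions on $\mathbb{R}$), and let $(\sigma_k)$ and $(\sigma^\circ_k)$ be the original and gaslighted information states generated with the same controls and the same observations. Then, regardless of the controls $u_0,u_1,\dots,u_{K-1}$, $$\mathcal{J}_{\sigma^\circ_K}-\mathcal{J}_{\sigma_K}\;\le\; e_\Phi\cdot\mathbb{E}^\dagger\big[\tilde d_K(y_1,\dots,y_K)\big],$$ where $$\tilde d_K(y_1,\dots,y_K)=\frac{c^K d_0}{\prod_{i=1}^{K}\phi(y_i)}+\sum_{j=1}^{K}\frac{c^{\,K-j+1}\,\zeta}{\prod_{i=j+1}^{K}\phi(y_i)}\left|\frac{1}{\phi^\circ_j(y_j)}-\frac{1}{\phi(y_j)}\right|$$ (an empty product equals $1$).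
   Context: Consider the discrete-time system $x_{k+1}=b(x_k,u_k)+w_k$, $y_{k+1}=h(x_k)+v_k$ over a finite horizon $k=0,\dots,K$, with states in $\mathcal{X}\subset\mathbb{R}^n$ and real observations, where $w_k\in\mathbb{R}^n$ are i.i.d. with density $\psi$, $v_k\in\mathbb{R}$ are i.i.d. with density $\phi$, $v_k$ is independent of $x_0$ and the $w_k$, and the control $u_k$ lies in a compact set $U_k\subset\mathbb{R}^m$. Let $\mu>0$ be a risk-sensitivity parameter, $L(x,u)$ a real running cost and $\Phi(x)$ a real terminal cost. Original information states: $\sigma_{k+1}(z)=\int_{\mathbb{R}^n}\psi(z-b(\xi,u_k))\,e^{\mu L(\xi,u_k)}\,\frac{\phi(y_{k+1}-h(\xi))}{\phi(y_{k+1})}\,\sigma_k(\xi)\,d\xi$, with $\sigma_0\in L^1(\mathbb{R}^n)$ an initial probability density on $\mathcal{X}$. Gaslighted information states: $\sigma^\circ_{k+1}(z)=\int_{\mathbb{R}^n}\psi(z-b(\xi,u_k))\,e^{\mu L(\xi,u_k)}\,\frac{\phi(y_{k+1}-h(\xi))}{\phi^\circ_{k+1}(y_{k+1})}\,\sigma^\circ_k(\xi)\,d\xi$, with initial state $\sigma^\circ_0$. Densities in denominators are understood to be nonzero where they are evaluated. Information states are unnormalized densities of the state, regarded as elements of $L^1(\mathbb{R}^n)$. $\mathbb{E}^\dagger$ is expectation under the measure $\mathcal{P}^\dagger$ under which $y_1,\dots,y_K$ are i.i.d. with density $\phi$ (also when the information states are gaslighted). The decision-maker's objective associated with an information state process is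 $\mathcal{J}_{\sigma_K}=\mathbb{E}^\dagger\big[\int_{\mathbb{R}^n}\sigma_K(z)e^{\mu\Phi(z)}dz\big]$, and likewise $\mathcal{J}_{\sigma^\circ_K}=\mathbb{E}^\dagger\big[\int_{\mathbb{R}^n}\sigma^\circ_K(z)e^{\mu\Phi(z)}dz\big]$. The metric is $d(\sigma^1,\sigma^2)=\int_{\mathbb{R}^n}|\sigma^1(z)-\sigma^2(z)|\,dz$, and $d_0=d(\sigma^\circ_0,\sigma_0)$. Constants (the maxima are assumed to exist and be finite): $\hat\phi=\max_y\phi(y)$; $l=\max_{x,u}e^{\mu L(x,u)}$; $c=\hat\phi\, l$; $e_\Phi=\max_{x\in\mathcal{X}}e^{\mu\Phi(x)}$; $\zeta>0$ is the maximum $L^1$-norm of all possible information states (over all stages, original and gaslighted). *)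

(* Defs.v *)
From HB Require Import structures.
From mathcomp Require Import all_boot all_order all_algebra.
From mathcomp Require Import all_classical all_reals all_analysis.

Set Implicit Arguments.
Unset Strict Implicit.
Unset Printing Implicit Defensive.

Import Order.TTheory GRing.Theory Num.Theory.
Import numFieldNormedType.Exports.

Local Open Scope classical_set_scope.
Local Open Scope ring_scope.

Section lebesgue_measure_cons.
Context {R : realType} (n : nat).
Variable nu : {sigma_finite_measure set (n.-tuple R) -> \bar R}.

Definition tcons (p : R * n.-tuple R) : n.+1.-tuple R := [tuple of p.1 :: p.2].

Lemma measurable_tcons : measurable_fun [set: R * n.-tuple R] tcons.
Proof. exact: measurable_cons. Qed.

Definition lebesgue_cons : set (n.+1.-tuple R) -> \bar R :=
  pushforward (@lebesgue_measure R \x nu)%E tcons.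

Let lebesgue_cons0 : lebesgue_cons set0 = 0%E.
Proof. by rewrite /lebesgue_cons /pushforward preimage_set0 measure0. Qed.

Let lebesgue_cons_ge0 A : (0 <= lebesgue_cons A)%E.
Proof. by rewrite /lebesgue_cons /pushforward; exact: measure_ge0. Qed.

Let lebesgue_cons_sigma_additive : semi_sigma_additive lebesgue_cons.
Proof.
move=> F mF tF mUF; rewrite /lebesgue_cons /pushforward preimage_bigcup.
have mpre A : measurable A -> measurable (tcons @^-1` A).
  by move=> mA; rewrite -[X in measurable X]setTI; exact: measurable_tcons.
apply: measure_semi_sigma_additive.
- by move=> i; exact: mpre.
- apply/trivIsetP => i j _ _ ij; rewrite -preimage_setI.
  by move/trivIsetP : tF => /(_ _ _ _ _ ij) ->//; rewrite preimage_set0.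
- by rewrite -preimage_bigcup; exact: mpre.
Qed.

HB.instance Definition _ := isMeasure.Build _ _ _ lebesgue_cons
  lebesgue_cons0 lebesgue_cons_ge0 lebesgue_cons_sigma_additive.

Let lebesgue_cons_sigma_finite : sigma_finite setT lebesgue_cons.
Proof.
pose g (t : n.+1.-tuple R) : R * n.-tuple R := (thead t, [tuple of behead t]).
have gK : cancel tcons g.
  by move=> [x t]; rewrite /g /tcons theadE; congr pair; exact: val_inj.
have mg : measurable_fun setT g.
  by apply: measurable_fun_pair; [exact: measurable_tnth|exact: measurable_behead].
have /sigma_finiteP[F [TF ndF Foo]] := sigma_finiteT (@lebesgue_measure R).
have /sigma_finiteP[G [TG ndG Goo]] := sigma_finiteT nu.
exists (fun k => g @^-1` (F k `*` G k)) => [|k].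
  rewrite -preimage_bigcup (_ : \bigcup_k _ = setT) ?preimage_setT//.
  rewrite -setXTT TF TG predeqE => -[x y]; split.
    by move=> [k _ []/= ? ?]; split; exists k.
  move=> [/= [i _ Fix] [k _ Gky]]; exists (maxn i k) => //; split.
  - by move: x Fix; exact/subsetPset/ndF/leq_maxl.
  - by move: y Gky; exact/subsetPset/ndG/leq_maxr.
have [mF Fk] := Foo k; have [mG Gk] := Goo k; split.
  by rewrite -[X in measurable X]setTI; apply: mg => //; exact: measurableX.
rewrite /lebesgue_cons /pushforward -comp_preimage.
rewrite (_ : g \o tcons = id); last by apply/funext => p /=; exact: gK.
by rewrite preimage_id product_measure1E// lte_mul_pinfty// ge0_fin_numE.
Qed.

HB.instance Definition _ := Measure_isSigmaFinite.Build _ _ _ lebesgue_cons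
  lebesgue_cons_sigma_finite.

End lebesgue_measure_cons.

(* Lebesgue measure on R^n, with R^n encoded as [n.-tuple R]. *)
Fixpoint lebesgueRn (R : realType) (n : nat) :
    {sigma_finite_measure set (n.-tuple R) -> \bar R} :=
  match n with
  | 0 => \d_([tuple] : 0.-tuple R)
  | p.+1 => lebesgue_cons (lebesgueRn R p)
  end.

(* On measurable rectangles [lebesgueRn] is the product of the one-dimensional
   measures, which characterizes it. *)
Lemma lebesgueRn_rect (R : realType) (n : nat) (A : 'I_n -> set R) :
  (forall i, measurable (A i)) ->
  lebesgueRn R n [set t | forall i, A i (tnth t i)] =
  (\prod_(i < n) lebesgue_measure (A i))%E.
Proof.
elim: n A => [|n IHn] A mA.
  rewrite big_ord0 /= diracE mem_set//.
  by case.
have mB : measurable [set t | forall i : 'I_n, A (lift ord0 i) (tnth t i)].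
  rewrite (_ : mkset _ = \bigcap_(i in [set: 'I_n])
      ((@tnth n R)^~ i @^-1` A (lift ord0 i))).
    apply: fin_bigcap_measurable => // i _.
    by rewrite -[X in measurable X]setTI; exact: measurable_tnth.
  by apply/seteqP; split => t /= At i; [move=> _; exact: At|exact: At].
rewrite big_ord_recl -IHn; last by move=> i; exact: mA.
rewrite /= /lebesgue_cons /pushforward -product_measure1E; [|exact: mA|exact: mB].
congr (product_measure1 _ _ _); apply/seteqP; split => [[x t]/= At|[x t]/= [Ax At] i].
  by split => [|i]; [exact: (At ord0)|have := At (lift ord0 i); rewrite tnthS].
by case: (unliftP ord0 i) => [j ->|->//]; rewrite tnthS.
Qed.

Definition tadd (R : realType) (n : nat) (a b : n.-tuple R) : n.-tuple R :=
  [tuple tnth a i + tnth b i | i < n].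

Definition tsub (R : realType) (n : nat) (a b : n.-tuple R) : n.-tuple R :=
  [tuple tnth a i - tnth b i | i < n].

(* Tuples carry no topology in the library; compactness is that of the
   corresponding set of row vectors. *)
Definition compact_Rn (R : realType) (n : nat) (A : set (n.-tuple R)) : Prop :=
  compact [set (\row_i tnth t i : 'rV[R]_n) | t in A].

Definition is_maximum d (T : porderType d) (A : set T) (m : T) : Prop :=
  A m /\ ubound A m.

Definition is_pdf d (T : measurableType d) (R : realType)
    (nu : {measure set T -> \bar R}) (f : T -> R) : Prop :=
  [/\ measurable_fun setT f, forall x, 0 <= f x & (\int[nu]_x (f x)%:E = 1)%E].

(* Only the indices 1, ..., K of [y] matter. *)
Definition iid_with_density d (Omega : measurableType d) (R : realType)
    (P : probability Omega R) (K : nat) (y : nat -> {RV P >-> R})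
    (phi : R -> R) : Prop :=
  (forall (k : nat) (B : set R), (1 <= k <= K)%N -> measurable B ->
     P (y k @^-1` B) = (\int[lebesgue_measure]_(t in B) (phi t)%:E)%E) /\
  (forall (J : seq nat) (B : nat -> set R),
     uniq J -> (forall k, k \in J -> (1 <= k <= K)%N) ->
     (forall k, measurable (B k)) ->
     P (\bigcap_(k in [set` J]) (y k @^-1` B k)) =
     (\prod_(k <- J) P (y k @^-1` B k))%E).

Section information_states.
Context {R : realType} {n m : nat}.
Variables (mu : R) (b : n.-tuple R -> m.-tuple R -> n.-tuple R)
  (h : n.-tuple R -> R) (L : n.-tuple R -> m.-tuple R -> R)
  (psi : n.-tuple R -> R) (phi : R -> R).

(* Information states along a control sequence [u] and an observation sequence
   [y], where [chi k] is the density in the denominator at time k: it is [phi]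
   for the original states and the k-th gaslighting density for the gaslighted
   ones. The value at k involves only u 0, ..., u (k-1) and y 1, ..., y k.
   As the integral is real-valued, the state is 0 at the points z where the
   integral diverges; these matter only up to a null set. *)
Fixpoint info_state (chi : nat -> R -> R) (s0 : n.-tuple R -> R)
    (u : nat -> m.-tuple R) (y : nat -> R) (k : nat) : n.-tuple R -> R :=
  match k with
  | 0 => s0
  | p.+1 => fun z =>
      \int[lebesgueRn R n]_xi
        (psi (tsub z (b xi (u p))) * expR (mu * L xi (u p)) *
         (phi (y p.+1 - h xi) / chi p.+1 (y p.+1)) *
         info_state chi s0 u y p xi)
  end.

Definition dist_L1 (s1 s2 : n.-tuple R -> R) : R :=
  \int[lebesgueRn R n]_z `|s1 z - s2 z|.

Definition norm_L1 (s : n.-tuple R -> R) : \bar R :=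
  (\int[lebesgueRn R n]_z `|s z|%:E)%E.

(* The L^1 norms of all possible information states up to stage K: all
   admissible control values and all observation values at which the densities
   in the denominators do not vanish. *)
Definition info_norms (K : nat) (U : nat -> set (m.-tuple R))
    (chi : nat -> R -> R) (s0 : n.-tuple R -> R) : set (\bar R) :=
  [set r | exists (k : nat) (u : nat -> m.-tuple R) (y : nat -> R),
     [/\ (k <= K)%N,
         forall i, (i < k)%N -> U i (u i),
         forall i, (1 <= i <= k)%N -> phi (y i) != 0 /\ chi i (y i) != 0
       & r = norm_L1 (info_state chi s0 u y k)]].

(* [S w] is the terminal information state at the outcome [w]; the integrals
   are extended-real. *)
Definition objective d (Omega : measurableType d) (P : probability Omega R)
    (Phi : n.-tuple R -> R) (S : Omega -> n.-tuple R -> R) : \bar R :=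
  (\int[P]_w \int[lebesgueRn R n]_z (S w z * expR (mu * Phi z))%:E)%E.

Definition dtilde (phio : nat -> R -> R) (c zeta d0 : R) (K : nat)
    (y : nat -> R) : R :=
  c ^+ K * d0 / \prod_(1 <= i < K.+1) phi (y i) +
  \sum_(1 <= j < K.+1)
    c ^+ (K - j).+1 * zeta / \prod_(j.+1 <= i < K.+1) phi (y i) *
    `|(phio j (y j))^-1 - (phi (y j))^-1|.

End information_states.

(* Main.v *)
Require Import Defs.
From HB Require Import structures.
From mathcomp Require Import all_boot all_order all_algebra.
From mathcomp Require Import all_classical all_reals all_analysis.
From mathcomp Require Import measurable_realfun ring.

Set Implicit Arguments.
Unset Strict Implicit.
Unset Printing Implicit Defensive.

Import Order.TTheory GRing.Theory Num.Theory.
Import numFieldNormedType.Exports.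

Local Open Scope classical_set_scope.
Local Open Scope ring_scope.

(** One step of the recursion applies to [sigma_k / chi(y_(k+1))] the integral
    operator with kernel [psi(z - b(xi,u)) e^(mu L(xi,u)) phi(y - h(xi))]. By
    Tonelli and the translation invariance of Lebesgue measure this operator has
    L^1 norm at most [c] on functions vanishing off [X], and by [X_states] its
    values vanish off [X] again. Writing
      [so / phio - s / phi = (so - s) / phi + (1 / phio - 1 / phi) so]
    the distances therefore satisfy
      [d_(k+1) <= c (d_k / phi(y_(k+1)) + zeta |1 / phio - 1 / phi|)],
    which with equality is the recursion defining [dtilde]. Weighting by
    [e^(mu Phi)], at most [ePhi] on [X], and taking expectations concludes;
    almost surely no denominator vanishes at the observations. *)

(** * Measurability of reciprocals and of parametrized real integrals *)

(** [x^-1 = x * (x ^+ 2)^-1] holds even at 0, where the inverse is 0 by convention. Squaring makes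
    the base nonnegative, so that the inverse is the measurable power of exponent -1. *)
Lemma measurable_funV d (T : measurableType d) (R : realType) (f : T -> R) :
  measurable_fun setT f -> measurable_fun setT (fun x => (f x)^-1).
Proof.
move=> mf; rewrite (_ : (fun _ => _) = (fun x => f x * (f x ^+ 2) `^ (-1))).
  apply: measurable_funM => //.
  exact/(measurableT_comp (measurable_powR _))/measurable_funX.
apply/funext => x; rewrite powR_inv1 ?sqr_ge0//.
have [->|f0] := eqVneq (f x) 0; first by rewrite invr0 mul0r.
by rewrite expr2 invfM mulrA divff ?mul1r.
Qed.

(** Tonelli gives measurability of the integrals of the positive and negative parts with values in
    the extended reals. Their difference and then [fine] preserve it, so divergent integrals do no
    harm. *)
Lemma measurable_Rintegral d1 d2 (T1 : measurableType d1)
    (T2 : measurableType d2) (R : realType)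
    (nu : {sigma_finite_measure set T2 -> \bar R}) (F : T1 * T2 -> R) :
  measurable_fun setT F ->
  measurable_fun setT (fun x => \int[nu]_y F (x, y)).
Proof.
move=> mF; apply: (measurableT_comp (@fine_measurable R setT measurableT)).
have mEF : measurable_fun setT (EFin \o F) by exact/measurable_EFinP.
rewrite [X in measurable_fun _ X](_ : _ = (fun x =>
    fubini_F nu (EFin \o F)^\+%E x -
    fubini_F nu (EFin \o F)^\-%E x)%E); last first.
  apply/funext => x; rewrite integralE /fubini_F /=.
  by congr (_ - _)%E; apply: eq_integral => y' _; rewrite ?funeposE ?funenegE.
apply: emeasurable_funB.
- by apply: measurable_fun_fubini_tonelli_F => //; exact: measurable_funepos.
- by apply: measurable_fun_fubini_tonelli_F => //; exact: measurable_funeneg.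
Qed.

(** * Translation invariance of Lebesgue measure on R and on R^n *)

Section translation.
Context {R : realType}.

(** The translated measure agrees with Lebesgue measure on the intervals []p, q]], and these
    determine it. *)
Lemma lebesgue_measure_translate (a : R) (A : set R) : measurable A ->
  lebesgue_measure ((fun x => x - a) @^-1` A) = lebesgue_measure A.
Proof.
move=> mA.
have ma : measurable_fun [set: measurableTypeR R]
    (fun x : measurableTypeR R => x - a : measurableTypeR R).
  exact: measurable_funB.
have leb_unique := @lebesgue_measure_unique R (pushforward (@lebesgue_measure R)
  (fun x : measurableTypeR R => x - a : measurableTypeR R)).
rewrite [RHS]leb_unique// => X [[p q] _ <-]; rewrite /pushforward/=.
transitivity (lebesgue_measure `]p + a, q + a]%classic); last first.
  congr lebesgue_measure.
  by apply/seteqP; split => x /=; rewrite !in_itv/= ltrBrDr lerBlDr.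
rewrite !lebesgue_measure_itv/= !lte_fin ltrD2r -!EFinB.
by case: ifP => // _; congr (_%:E); ring.
Qed.

Lemma ge0_integral_translate (a : R) (f : R -> \bar R) :
  measurable_fun setT f -> (forall x, 0 <= f x)%E ->
  (\int[@lebesgue_measure R]_x f ((x : R) - a)%R =
   \int[@lebesgue_measure R]_x f x)%E.
Proof.
move=> mf f0.
have ma : measurable_fun [set: measurableTypeR R]
    (fun x : measurableTypeR R => x - a : measurableTypeR R).
  exact: measurable_funB.
rewrite -[LHS](ge0_integral_pushforward ma _ measurableT mf)//.
apply: eq_measure_integral => A mA _.
exact: lebesgue_measure_translate.
Qed.

Lemma measurable_tsub d (T : measurableType d) n (f g : T -> n.-tuple R) :
  measurable_fun setT f -> measurable_fun setT g ->
  measurable_fun setT (fun x => tsub (f x) (g x)).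
Proof.
move=> mf mg; apply/measurable_fun_tnthP => i.
rewrite (_ : _ \o _ = (fun x => tnth (f x) i - tnth (g x) i)); last first.
  by apply/funext => x /=; rewrite tnth_mktuple.
by apply: measurable_funB; exact: (measurableT_comp (measurable_tnth i)).
Qed.

(** By construction [lebesgueRn R n.+1] is the image of a product measure under [tcons], so a change
    of variables followed by Tonelli splits off the first coordinate. *)
Lemma ge0_integral_lebesgueRnS n (f : n.+1.-tuple R -> \bar R) :
  measurable_fun setT f -> (forall t, 0 <= f t)%E ->
  (\int[lebesgueRn R n.+1]_t f t =
   \int[@lebesgue_measure R]_x \int[lebesgueRn R n]_t f (tcons (x, t)))%E.
Proof.
move=> mf f0.
have mtc : measurable_fun [set: measurableTypeR R * n.-tuple R] (@tcons R n).
  exact: measurable_tcons.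
transitivity (
    \int[(@lebesgue_measure R \x lebesgueRn R n)%E]_p (f \o @tcons R n) p)%E.
  by rewrite -(ge0_integral_pushforward mtc
    (@lebesgue_measure R \x lebesgueRn R n)%E measurableT mf).
exact: (fubini_tonelli1 _ (measurableT_comp mf mtc) (fun p => f0 _)).
Qed.

(** Induction on the dimension: after the first coordinate is split off, the one-dimensional
    invariance shifts the head and the induction hypothesis shifts the tail. *)
Lemma ge0_integral_lebesgueRn_translate n (a : n.-tuple R)
    (f : n.-tuple R -> \bar R) :
  measurable_fun setT f -> (forall t, 0 <= f t)%E ->
  (\int[lebesgueRn R n]_t f (tsub t a) = \int[lebesgueRn R n]_t f t)%E.
Proof.
elim: n a f => [|n IHn] a f mf f0.
  by apply: eq_integral => t _; congr f; rewrite [LHS]tuple0 [RHS]tuple0.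
have mcf : measurable_fun setT (f \o @tcons R n).
  by apply: measurableT_comp => //; exact: measurable_tcons.
have mfa : measurable_fun setT (fun t => f (tsub t a)).
  apply: measurableT_comp => //.
  by apply: measurable_tsub; [exact: measurable_id|exact: measurable_cst].
apply: etrans (ge0_integral_lebesgueRnS mfa _) _ => //.
apply: etrans _ (esym (ge0_integral_lebesgueRnS mf f0)).
(* The head is shifted on the right-hand side, so that both outer integrals run over the same [x]
   and only the tails remain to be compared. *)
rewrite -[RHS](ge0_integral_translate (thead a)); last 2 first.
- exact: (measurable_fun_fubini_tonelli_F _ mcf (fun p => f0 _)).
- by move=> x; exact: integral_ge0.
apply: eq_integral => x _.
pose xa := (x : R) - thead a.
have mcfx : measurable_fun setT (fun t => f (tcons (xa, t))).
  exact: (measurableT_comp mcf (measurable_pair1 xa)).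
apply: etrans _ (IHn [tuple of behead a] _ mcfx (fun=> f0 _)).
apply: eq_integral => t _; congr f; apply: eq_from_tnth => i.
rewrite tnth_mktuple; case: (unliftP ord0 i) => [j ->|->].
  rewrite !tnthS tnth_mktuple tnth_behead; congr (_ - tnth _ _).
  by apply: ord_inj; rewrite lift0 inordK// ltnS.
by rewrite !tnth0.
Qed.

End translation.

(** * L^1 bounds for integral operators with nonnegative kernels *)

Section integral_operator.
Context d (T : measurableType d) (R : realType).
Variables (nu : {sigma_finite_measure set T -> \bar R}) (X : set T).
Implicit Types (q : T * T -> R) (f g : T -> R).

Definition integral_op q f (z : T) : R := \int[nu]_xi (q (z, xi) * f xi).

Lemma measurable_integral_op q f : measurable_fun setT q ->
  measurable_fun setT f -> measurable_fun setT (integral_op q f).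
Proof.
move=> mq mf.
apply: (measurable_Rintegral nu (F := fun p => q p * f p.2)).
by apply: measurable_funM => //; exact: measurableT_comp.
Qed.

(** After exchanging the integrals, each [xi] contributes [|f xi|] times the kernel mass at [xi].
    That mass is at most [c] on [X], and elsewhere [f] vanishes almost everywhere. *)
Lemma tonelli_integral_op_le q f (c : R) : measurable_fun setT q ->
  (forall p, 0 <= q p) -> 0 <= c ->
  (forall xi, X xi -> \int[nu]_z (q (z, xi))%:E <= c%:E)%E ->
  measurable_fun setT f -> {ae nu, forall xi, ~ X xi -> f xi = 0} ->
  (\int[nu]_z \int[nu]_xi `|(q (z, xi) * f xi)%:E| <=
   c%:E * \int[nu]_xi `|(f xi)%:E|)%E.
Proof.
move=> mq q0 c0 qc mf fX.
have mF : measurable_fun setT (fun p : T * T => `|(q p * f p.2)%:E|%E).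
  apply: measurableT_comp => //; apply/measurable_EFinP.
  by apply: measurable_funM => //; exact: measurableT_comp.
have mabsf : measurable_fun setT (fun xi => `|(f xi)%:E|%E).
  by apply: measurableT_comp => //; exact/measurable_EFinP.
rewrite (fubini_tonelli _ mF (fun p => abse_ge0 _))/=.
rewrite -(ge0_integralZl nu measurableT mabsf (k := c%:E))//.
apply: ae_ge0_le_integral => //.
- by move=> xi _; exact: integral_ge0.
- exact: (measurable_fun_fubini_tonelli_G _ mF).
- by move=> xi _; rewrite mule_ge0// lee_fin.
- exact: measurable_funeM.
apply: filterS fX => xi fX _.
rewrite abse_EFin; under eq_integral do rewrite normrM ger0_norm// mulrC EFinM.
have mqx : measurable_fun setT (fun z => (q (z, xi))%:E).
  by apply/measurable_EFinP; exact: (measurableT_comp mq (measurable_pair2 xi)).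
rewrite ge0_integralZl//; last by move=> z _; rewrite lee_fin.
have [Xxi|/fX ->] := pselect (X xi); last by rewrite normr0 mul0e mule0.
by rewrite muleC; apply: lee_wpmul2r => //; exact: qc.
Qed.

(* No integrability is needed: [fine] sends infinite values to 0. *)
Lemma normr_integral_op_le q f z : measurable_fun setT q ->
  measurable_fun setT f ->
  (`|integral_op q f z|%:E <= \int[nu]_xi `|(q (z, xi) * f xi)%:E|)%E.
Proof.
move=> mq mf.
have mqf : measurable_fun setT (fun xi => (q (z, xi) * f xi)%:E).
  apply/measurable_EFinP/measurable_funM => //.
  exact: (measurableT_comp mq (measurable_pair1 z)).
apply: le_trans (le_abse_integral nu measurableT mqf).
by rewrite /integral_op /Rintegral; case: (integral _ _ _) => [r| |] /=;
  rewrite ?normr0 ?leey.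
Qed.

Lemma integral_op_L1_le q f (c : R) : measurable_fun setT q ->
  (forall p, 0 <= q p) -> 0 <= c ->
  (forall xi, X xi -> \int[nu]_z (q (z, xi))%:E <= c%:E)%E ->
  measurable_fun setT f -> {ae nu, forall xi, ~ X xi -> f xi = 0} ->
  (\int[nu]_z `|integral_op q f z|%:E <= c%:E * \int[nu]_xi `|f xi|%:E)%E.
Proof.
move=> mq q0 c0 qc mf fX; apply: le_trans (tonelli_integral_op_le mq q0 c0 qc mf fX).
apply: ge0_le_integral => //.
- by apply/measurable_EFinP/measurableT_comp => //; exact: measurable_integral_op.
- apply: (measurable_fun_fubini_tonelli_F (fun p => `|(q p * f p.2)%:E|%E)) => //.
  apply: measurableT_comp => //; apply/measurable_EFinP.
  by apply: measurable_funM => //; exact: measurableT_comp.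
- by move=> z _; exact: normr_integral_op_le.
Qed.

(** The operator is linear only where the integrals converge, because a divergent one is replaced by
    0. The Tonelli bound makes the divergence points a null set, so the difference of the images is
    almost everywhere the image of [f - g], to which the L^1 bound applies. *)
Lemma integral_op_dist_le q f g (c : R) : measurable_fun setT q ->
  (forall p, 0 <= q p) -> 0 <= c ->
  (forall xi, X xi -> \int[nu]_z (q (z, xi))%:E <= c%:E)%E ->
  nu.-integrable setT (EFin \o f) -> {ae nu, forall xi, ~ X xi -> f xi = 0} ->
  nu.-integrable setT (EFin \o g) -> {ae nu, forall xi, ~ X xi -> g xi = 0} ->
  (\int[nu]_z `|integral_op q f z - integral_op q g z|%:E <=
   c%:E * \int[nu]_xi `|f xi - g xi|%:E)%E.
Proof.
move=> mq q0 c0 qc.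
have ae_int k : nu.-integrable setT (EFin \o k) ->
    {ae nu, forall xi, ~ X xi -> k xi = 0} -> measurable_fun setT k /\
    {ae nu, forall z, nu.-integrable setT (EFin \o fun xi => q (z, xi) * k xi)}.
  move=> /integrableP[/measurable_EFinP mk koo] kX; split => //.
  have mF : measurable_fun setT (fun p : T * T => q p * k p.2).
    by apply: measurable_funM => //; exact: measurableT_comp.
  have mI : measurable_fun setT
      (fun z => \int[nu]_xi `|(q (z, xi) * k xi)%:E|)%E.
    apply: (measurable_fun_fubini_tonelli_F (fun p => `|(q p * k p.2)%:E|%E)) => //.
    by apply: measurableT_comp => //; apply/measurable_EFinP.
  (* The function of [z] given by the inner integrals has finite integral, hence is finite for
     almost every [z]. This is the integrability needed to subtract under the integral sign. *)
  have : nu.-integrable setT (fun z => \int[nu]_xi `|(q (z, xi) * k xi)%:E|)%E.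
    apply/integrableP; split => //.
    under eq_integral do rewrite gee0_abs ?integral_ge0//.
    apply: le_lt_trans (tonelli_integral_op_le mq q0 c0 qc mk kX) _.
    by rewrite lte_mul_pinfty// ?lee_fin.
  move=> /(integrable_ae measurableT); apply: filterS => z /(_ I) qkoo.
  apply/integrableP; split.
    by apply/measurable_EFinP; exact: (measurableT_comp mF (measurable_pair1 z)).
  by rewrite -ge0_fin_numE// integral_ge0.
move=> fi fX gi gX; have [mf fae] := ae_int _ fi fX; have [mg gae] := ae_int _ gi gX.
apply: le_trans (integral_op_L1_le mq q0 c0 qc (measurable_funB mf mg) _); last first.
  by apply: filterS2 fX gX => xi fX gX nX; rewrite /= fX ?gX ?subrr.
rewrite le_eqVlt; apply/orP; left; apply/eqP; apply: ge0_ae_eq_integral => //.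
- apply/measurable_EFinP/measurableT_comp => //.
  by apply: measurable_funB; exact: measurable_integral_op.
- apply/measurable_EFinP/measurableT_comp => //.
  by apply: measurable_integral_op => //; exact: measurable_funB.
apply: filterS2 fae gae => z fz gz _; congr (`|_|%:E).
rewrite /integral_op -RintegralB//.
by apply: eq_Rintegral => xi _; rewrite /= mulrBr.
Qed.

(** The kernel is cut off to outputs in [Y]. The truncated kernel has mass 0 at every point of [X],
    so the L^1 bound with constant 0 makes its image vanish almost everywhere, and on [Y] truncation
    changes nothing. *)
Lemma integral_op_eq0 q f (Y : set T) : measurable Y -> measurable_fun setT q ->
  (forall p, 0 <= q p) ->
  (forall xi, X xi -> \int[nu]_(z in Y) (q (z, xi))%:E = 0)%E ->
  measurable_fun setT f -> {ae nu, forall xi, ~ X xi -> f xi = 0} ->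
  {ae nu, forall z, Y z -> integral_op q f z = 0}.
Proof.
move=> mY mq q0 qY mf fX.
pose q' p := q p * \1_Y p.1.
have mq' : measurable_fun setT q'.
  by apply: measurable_funM => //; apply: measurableT_comp => //; exact: measurable_indic.
have mop := measurable_integral_op mq' mf.
have : (\int[nu]_z `|(integral_op q' f z)%:E| = 0)%E.
  apply/eqP; rewrite eq_le integral_ge0// andbT.
  apply: le_trans (integral_op_L1_le (c := 0) mq' _ _ _ mf fX) _ => //.
  - by move=> p; rewrite mulr_ge0// indicE ler0n.
  - move=> xi Xxi; rewrite -[leRHS](qY _ Xxi) [leRHS]integral_mkcond le_eqVlt.
    apply/orP; left; apply/eqP/eq_integral => z _; rewrite /q' patchE indicE /=.
    by case: (z \in Y); rewrite ?mulr1 ?mulr0.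
  - by rewrite mul0e.
have mE : measurable_fun setT (EFin \o integral_op q' f) by exact/measurable_EFinP.
move/(ae_eq_integral_abs nu measurableT mE); apply: filterS => z /(_ I) + Yz.
rewrite /= => -[<-]; apply: eq_Rintegral => xi _.
by rewrite /q' indicE mem_set ?mulr1.
Qed.

End integral_operator.

(** * The information state recursion: kernel, measurability and masses *)

Section information_states_theory.
Context {R : realType} {n m : nat}.
Variables (mu : R) (b : n.-tuple R -> m.-tuple R -> n.-tuple R)
  (h : n.-tuple R -> R) (L : n.-tuple R -> m.-tuple R -> R)
  (psi : n.-tuple R -> R) (phi : R -> R).
Hypothesis mb : measurable_fun setT
  (fun p : n.-tuple R * m.-tuple R => b p.1 p.2).
Hypothesis mh : measurable_fun setT h.
Hypothesis mL : measurable_fun setT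
  (fun p : n.-tuple R * m.-tuple R => L p.1 p.2).
Hypothesis psi_pdf : is_pdf (lebesgueRn R n) psi.
Hypothesis phi_pdf : is_pdf (@lebesgue_measure R) phi.

Let mpsi : measurable_fun setT psi. Proof. by case: psi_pdf. Qed.
Let psi0 x : 0 <= psi x. Proof. by case: psi_pdf. Qed.
Let mphi : measurable_fun [set: R] phi. Proof. by case: phi_pdf. Qed.
Let phi0 x : 0 <= phi x. Proof. by case: phi_pdf. Qed.

Local Notation state := (info_state mu b h L psi phi).

(** The denominator is kept out of the kernel and attached to the state instead. Original and
    gaslighted states then evolve under one operator, applied to differently scaled functions. *)
Definition state_kernel (v : m.-tuple R) (t : R) (p : n.-tuple R * n.-tuple R) :=
  psi (tsub p.1 (b p.2 v)) * expR (mu * L p.2 v) * phi (t - h p.2).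

Lemma measurable_state_kernel d (T : measurableType d) (v : T -> m.-tuple R)
    (t : T -> R) (z xi : T -> n.-tuple R) :
  measurable_fun setT v -> measurable_fun setT t ->
  measurable_fun setT z -> measurable_fun setT xi ->
  measurable_fun setT (fun x => state_kernel (v x) (t x) (z x, xi x)).
Proof.
move=> mv mt mz mxi; have mxv := measurable_fun_pair mxi mv.
apply: measurable_funM; first apply: measurable_funM.
- apply: (measurableT_comp mpsi); apply: measurable_tsub => //.
  exact: (measurableT_comp mb mxv).
- apply: (measurableT_comp (@measurable_expR R)).
  by apply: measurable_funM => //; exact: (measurableT_comp mL mxv).
- apply: (measurableT_comp mphi); apply: measurable_funB => //.
  exact: (measurableT_comp mh mxi).
Qed.

Lemma info_stateS chi s0 u y k :
  state chi s0 u y k.+1 =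
  integral_op (lebesgueRn R n) (state_kernel (u k) (y k.+1))
    (fun xi => (chi k.+1 (y k.+1))^-1 * state chi s0 u y k xi).
Proof.
apply/funext => z /=; apply: eq_Rintegral => xi _.
by rewrite /state_kernel /=; ring.
Qed.

Lemma info_state_ge0 chi s0 u y k : (forall z, 0 <= s0 z) ->
  (forall i, (1 <= i <= k)%N -> 0 <= chi i (y i)) ->
  forall z, 0 <= state chi s0 u y k z.
Proof.
move=> s00; elim: k => [|k IHk] chi0 z //=.
apply: Rintegral_ge0 => xi _; rewrite !mulr_ge0 ?expR_ge0// ?invr_ge0.
  by rewrite chi0 ?ltnSn.
by apply: IHk => i /andP[i1 ik]; rewrite chi0// i1 leqW.
Qed.

(** Joint measurability in the outcome and the state variable is what later makes the integral
    against [e^(mu Phi)] a measurable function of the outcome. *)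
Lemma measurable_info_state d (T : measurableType d) (K : nat)
    (chi : nat -> R -> R) s0 (u : nat -> T -> m.-tuple R) (y : nat -> T -> R) k :
  measurable_fun setT s0 ->
  (forall i, (1 <= i <= K)%N -> measurable_fun [set: R] (chi i)) ->
  (forall i, (i < K)%N -> measurable_fun setT (u i)) ->
  (forall i, measurable_fun setT (y i)) -> (k <= K)%N ->
  measurable_fun setT (fun p : T * n.-tuple R =>
    state chi s0 (u^~ p.1) (y^~ p.1) k p.2).
Proof.
move=> ms0 mchi mu_ my; elim: k => [|k IHk] kK.
  exact: measurableT_comp.
under eq_fun do rewrite info_stateS.
apply: (measurable_Rintegral (lebesgueRn R n)
  (F := fun p : T * n.-tuple R * n.-tuple R =>
  state_kernel (u k p.1.1) (y k.+1 p.1.1) (p.1.2, p.2) *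
  ((chi k.+1 (y k.+1 p.1.1))^-1 * state chi s0 (u^~ p.1.1) (y^~ p.1.1) k p.2))).
have m11 : measurable_fun setT (fun p : T * n.-tuple R * n.-tuple R => p.1.1).
  exact: measurableT_comp.
apply: measurable_funM; last apply: measurable_funM.
- apply: measurable_state_kernel => //.
  + exact: (measurableT_comp (mu_ _ kK) m11).
  + exact: (measurableT_comp (my _) m11).
  + exact: measurableT_comp.
- apply: measurable_funV; apply: (measurableT_comp (mchi k.+1 _)) => //.
  exact: (measurableT_comp (my _) m11).
- exact: (measurableT_comp (IHk (ltnW kK)) (measurable_fun_pair m11 measurable_snd)).
Qed.

Lemma measurable_info_state1 (K : nat) (chi : nat -> R -> R) s0 u y k :
  measurable_fun setT s0 ->
  (forall i, (1 <= i <= K)%N -> measurable_fun [set: R] (chi i)) ->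
  (k <= K)%N -> measurable_fun setT (state chi s0 u y k).
Proof.
move=> ms0 mchi kK.
(* Constant controls and observations over the dummy parameter space [R] reduce this to the joint
   statement, of which the section at 0 is then taken. *)
have /= := measurable_info_state (T := R) (u := fun i => cst (u i))
  (y := fun i => cst (y i)) ms0 mchi _ _ kK.
move=> /(_ (fun _ _ => measurable_cst _) (fun _ => measurable_cst _)) mF.
exact: (measurableT_comp mF (measurable_pair1 (0 : R))).
Qed.

(** Only the factor [psi (z - b)] depends on [z], and by translation invariance it integrates to
    1. *)
Lemma integral_state_kernel v t xi :
  (\int[lebesgueRn R n]_z (state_kernel v t (z, xi))%:E =
   (expR (mu * L xi v) * phi (t - h xi))%:E)%E.
Proof.
pose a := expR (mu * L xi v) * phi (t - h xi).
have a0 : 0 <= a by rewrite mulr_ge0 ?expR_ge0.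
transitivity (\int[lebesgueRn R n]_z (a%:E * (psi (tsub z (b xi v)))%:E))%E.
  by apply: eq_integral => z _; rewrite -EFinM /state_kernel /a /=; congr EFin; ring.
rewrite ge0_integralZl//.
- rewrite (ge0_integral_lebesgueRn_translate (b xi v) (f := fun z => (psi z)%:E)).
  + by case: psi_pdf => _ _ ->; rewrite mule1.
  + exact/measurable_EFinP.
  + by move=> z; rewrite lee_fin.
- apply/measurable_EFinP/(measurableT_comp mpsi)/measurable_tsub.
    exact: measurable_id.
  exact: measurable_cst.
- by move=> z _; rewrite lee_fin.
Qed.

Lemma tadd_tsubK (a z : n.-tuple R) : tadd a (tsub z a) = z.
Proof. by apply: eq_from_tnth => i; rewrite !tnth_mktuple; ring. Qed.

Lemma measurable_tadd_preimage (X : set (n.-tuple R)) a : measurable X ->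
  measurable [set w | X (tadd a w)].
Proof.
move=> mX; rewrite -[X in measurable X]setTI.
suff : measurable_fun setT (tadd a) by apply.
apply/measurable_fun_tnthP => i.
rewrite (_ : _ \o _ = (fun w => tnth a i + tnth w i)); last first.
  by apply/funext => x /=; rewrite tnth_mktuple.
by apply: measurable_funD => //; exact: measurable_tnth.
Qed.

(** Translation by [b xi v] turns the mass outside [X] into a multiple of the [psi]-mass of the
    noises that lead out of [X]. This mass is 0, since [psi] has mass 1 both in total and on the
    complementary set. *)
Lemma integral_state_kernel_setC (X : set (n.-tuple R)) v t xi : measurable X ->
  (\int[lebesgueRn R n]_(w in [set w | X (tadd (b xi v) w)]) (psi w)%:E = 1)%E ->
  (\int[lebesgueRn R n]_(z in ~` X) (state_kernel v t (z, xi))%:E = 0)%E.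
Proof.
move=> mX psi1.
have mA := measurable_tadd_preimage (b xi v) mX.
set A := [set w | _] in psi1 mA.
have mEpsi : measurable_fun setT (EFin \o psi) by exact/measurable_EFinP.
have psiE0 D : forall x, D x -> (0 <= (EFin \o psi) x)%E by move=> x _; rewrite lee_fin.
have psiC0 : (\int[lebesgueRn R n]_(w in ~` A) (psi w)%:E = 0)%E.
  have := @ge0_integral_setU _ _ _ (lebesgueRn R n) _ _ mA (measurableC mA) (EFin \o psi).
  rewrite setUv => /(_ mEpsi (psiE0 _)).
  have -> : [disjoint A & ~` A] by apply/disj_setPCl.
  case: psi_pdf => _ _ /= -> /(_ isT); rewrite psi1.
  move/esym; rewrite -[in X in _ = X](adde0 1%:E).
  by case: (integral _ _ _) => [r| |]//= [/addrI ->].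
pose a := expR (mu * L xi v) * phi (t - h xi).
have a0 : 0 <= a by rewrite mulr_ge0 ?expR_ge0.
rewrite integral_mkcond.
transitivity (\int[lebesgueRn R n]_z
  (a%:E * ((EFin \o psi) \_ (~` A)) (tsub z (b xi v))))%E.
  apply: eq_integral => z _; rewrite !patchE.
  have -> : (tsub z (b xi v) \in ~` A) = (z \in ~` X).
    by apply/idP/idP => /set_mem Xz; apply/mem_set; move: Xz; rewrite /A /= tadd_tsubK.
  case: ifP => _; last by rewrite mule0.
  by rewrite -EFinM /state_kernel /a /=; congr EFin; ring.
have mpsiA : measurable_fun setT ((EFin \o psi) \_ (~` A)).
  apply/(measurable_restrictT _ (measurableC mA)).
  exact: measurable_funS mEpsi.
have psiA0 w : (0 <= ((EFin \o psi) \_ (~` A)) w)%E.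
  by apply: erestrict_ge0 => x _; rewrite lee_fin.
rewrite ge0_integralZl//; last first.
  apply: (measurableT_comp mpsiA); apply: measurable_tsub.
    exact: measurable_id.
  exact: measurable_cst.
rewrite (ge0_integral_lebesgueRn_translate (b xi v) (f := (EFin \o psi) \_ (~` A)))//.
by rewrite -integral_mkcond psiC0 mule0.
Qed.

(** * Confinement of the states to [X] and the recursion for their distances *)

Variables (K : nat) (X : set (n.-tuple R)) (U : nat -> set (m.-tuple R)).
Variables (phihat l : R).
Hypothesis mX : measurable X.
Hypothesis X_states : forall k x v, (k < K)%N -> X x -> U k v ->
  (\int[lebesgueRn R n]_(w in [set w | X (tadd (b x v) w)]) (psi w)%:E = 1)%E.
Hypothesis phi_le : forall t, phi t <= phihat.
Hypothesis l_ge0 : 0 <= l.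
Hypothesis cost_le : forall k x v, (k < K)%N -> X x -> U k v ->
  expR (mu * L x v) <= l.

Let c := phihat * l.
Let c_ge0 : 0 <= c.
Proof. by rewrite mulr_ge0// (le_trans (phi0 0)). Qed.

Lemma integral_state_kernel_le k v t xi : (k < K)%N -> U k v -> X xi ->
  (\int[lebesgueRn R n]_z (state_kernel v t (z, xi))%:E <= c%:E)%E.
Proof.
move=> kK Uv Xxi; rewrite integral_state_kernel lee_fin mulrC.
by rewrite ler_pM ?expR_ge0//; exact: cost_le Xxi Uv.
Qed.

Lemma state_kernel_ge0 v t p : 0 <= state_kernel v t p.
Proof. by rewrite !mulr_ge0 ?expR_ge0. Qed.

Lemma measurable_state_kernel2 v t : measurable_fun setT (state_kernel v t).
Proof.
rewrite (_ : state_kernel v t = (fun p => state_kernel v t (p.1, p.2))).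
  exact: (measurable_state_kernel (measurable_cst v) (measurable_cst t)).
by apply/funext => -[].
Qed.

(** The bounds on the running and terminal costs hold on [X] only, so the states must be known to
    vanish elsewhere. Each step applies [integral_op_eq0] with the complement of [X] as [Y]. *)
Lemma info_state_eq0 (chi : nat -> R -> R) (s0 : n.-tuple R -> R) u y k :
  measurable_fun setT s0 ->
  (forall i, (1 <= i <= K)%N -> measurable_fun [set: R] (chi i)) ->
  (forall i, (i < K)%N -> U i (u i)) ->
  {ae lebesgueRn R n, forall z, ~ X z -> s0 z = 0} -> (k <= K)%N ->
  {ae lebesgueRn R n, forall z, ~ X z -> state chi s0 u y k z = 0}.
Proof.
move=> ms0 mchi Uu s0X; elim: k => [//|k IHk] kK.
rewrite info_stateS.
have mk := measurable_info_state1 u y ms0 mchi (ltnW kK).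
apply: (integral_op_eq0 (X := X) (measurableC mX)).
- exact: measurable_state_kernel2.
- by move=> p; exact: state_kernel_ge0.
- move=> xi Xxi; apply: integral_state_kernel_setC => //.
  exact: X_states Xxi (Uu _ kK).
- exact: measurable_funM.
- by apply: filterS (IHk (ltnW kK)) => z z0 /z0 ->; rewrite mulr0.
Qed.

(** The new summand [j = k.+1] has an empty product and exponent 1, and every older term gains the
    factor [a / phi (y k.+1)]. *)
Lemma dtildeS (phio : nat -> R -> R) (a zeta d0 : R) k (y : nat -> R) :
  dtilde phi phio a zeta d0 k.+1 y =
  a * ((phi (y k.+1))^-1 * dtilde phi phio a zeta d0 k y +
     zeta * `|(phio k.+1 (y k.+1))^-1 - (phi (y k.+1))^-1|).
Proof.
rewrite /dtilde big_nat_recr//= (big_nat_recr k.+1 1)//=.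
rewrite [X in _ / X * _](big_geq (leqnn _)) subnn expr1 divr1.
rewrite !mulrDr addrA mulrA; congr (_ + _ + _).
  by rewrite exprS invfM; ring.
rewrite mulr_sumr [in RHS]mulr_sumr; apply: eq_big_nat => j /andP[j1 jk].
rewrite big_nat_recr//= subSn// exprS invfM; ring.
Qed.

(** Induction on the stage, with [dtildeS] matching the bound of one step. The integral is
    extended-real, so the inequality also carries the finiteness of the distance. *)
Lemma dist_info_state_le (phio : nat -> R -> R) (s0 s0o : n.-tuple R -> R) u y
    (zeta : R) :
  (forall i, (1 <= i <= K)%N -> measurable_fun [set: R] (phio i)) ->
  (forall i, (i < K)%N -> U i (u i)) ->
  (lebesgueRn R n).-integrable setT (EFin \o s0) ->
  {ae lebesgueRn R n, forall z, ~ X z -> s0 z = 0} ->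
  (lebesgueRn R n).-integrable setT (EFin \o s0o) ->
  {ae lebesgueRn R n, forall z, ~ X z -> s0o z = 0} ->
  (forall k, (k <= K)%N ->
    (norm_L1 (state (fun=> phi) s0 u y k) <= zeta%:E)%E) ->
  (forall k, (k <= K)%N -> (norm_L1 (state phio s0o u y k) <= zeta%:E)%E) ->
  forall k, (k <= K)%N ->
  (\int[lebesgueRn R n]_z
      `|state phio s0o u y k z - state (fun=> phi) s0 u y k z|%:E <=
   (dtilde phi phio c zeta (dist_L1 s0o s0) k y)%:E)%E.
Proof.
move=> mphio Uu s0i s0X s0oi s0oX zs zso.
have /integrableP[/measurable_EFinP ms0 _] := s0i.
have /integrableP[/measurable_EFinP ms0o _] := s0oi.
have mS k : (k <= K)%N -> measurable_fun setT (state (fun=> phi) s0 u y k).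
  by move=> kK; apply: measurable_info_state1 kK.
have mSo k : (k <= K)%N -> measurable_fun setT (state phio s0o u y k).
  by move=> kK; apply: measurable_info_state1 kK.
(* The bounds by [zeta] supply the integrability that the distance estimate for the operator
   requires. *)
have inti s a : measurable_fun setT s -> (norm_L1 s <= zeta%:E)%E ->
    (lebesgueRn R n).-integrable setT (EFin \o (fun z => a * s z)).
  move=> ms sz; apply: (@eq_integrable _ _ _ _ _ measurableT
      (fun z => a%:E * (s z)%:E)%E) => //.
  apply: integrableZl => //; apply/integrableP; split; first exact/measurable_EFinP.
  by rewrite (le_lt_trans sz)// ltry.
elim=> [|k IHk] kK.
  (* At stage 0 both sides are the initial distance. [dist_L1] takes [fine] of an integral, so its
     finiteness has to be checked. *)
  rewrite /dtilde big_geq// big_geq// expr0 mul1r divr1 addr0 /dist_L1 /Rintegral.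
  rewrite fineK//=; apply: integrable_fin_num => //.
  exact: integrable_norm (integrableB _ s0oi s0i).
have {}IHk := IHk (ltnW kK).
rewrite !info_stateS dtildeS.
set f := fun xi => _ * state phio s0o u y k xi.
set g := fun xi => _ * state (fun=> phi) s0 u y k xi.
have fX : {ae lebesgueRn R n, forall z, ~ X z -> f z = 0}.
  apply: filterS (info_state_eq0 y ms0o mphio Uu s0oX (ltnW kK)) => z z0 /z0.
  by rewrite /f => ->; rewrite mulr0.
have gX : {ae lebesgueRn R n, forall z, ~ X z -> g z = 0}.
  apply: filterS (info_state_eq0 y ms0 (fun _ _ => mphi) Uu s0X (ltnW kK)) => z z0 /z0.
  by rewrite /g => ->; rewrite mulr0.
apply: le_trans (integral_op_dist_le (measurable_state_kernel2 _ _)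
  (@state_kernel_ge0 _ _) c_ge0
  (fun xi => integral_state_kernel_le (y k.+1) kK (Uu _ kK)) _ fX _ gX) _.
- by apply: inti; [exact: mSo (ltnW kK)|exact: zso (ltnW kK)].
- by apply: inti; [exact: mS (ltnW kK)|exact: zs (ltnW kK)].
rewrite [leRHS]EFinM; apply: lee_wpmul2l; first by rewrite lee_fin.
set p' := (phi (y k.+1))^-1; set e := `|_ - _|.
have p'0 : 0 <= p' by rewrite invr_ge0.
have e0 : 0 <= e by exact: normr_ge0.
pose A z := state phio s0o u y k z; pose B z := state (fun=> phi) s0 u y k z.
have mA : measurable_fun setT A by exact: mSo (ltnW kK).
have mB : measurable_fun setT B by exact: mS (ltnW kK).
have mnA : measurable_fun setT (fun z => `|A z|%:E).
  exact/measurable_EFinP/measurableT_comp.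
have mnAB : measurable_fun setT (fun z => `|A z - B z|%:E).
  by apply/measurable_EFinP/measurableT_comp => //; exact: measurable_funB.
(* Triangle inequality for [p' * (A - B)] plus the difference of reciprocals times [A]. The second
   term involves the gaslighted state [A], whose norm is bounded by [zeta]. *)
apply: (@le_trans _ _ (\int[lebesgueRn R n]_z
    (p'%:E * `|A z - B z|%:E + e%:E * `|A z|%:E))%E).
  apply: ge0_le_integral => //.
  - apply/measurable_EFinP/measurableT_comp => //.
    by apply: measurable_funB; exact: measurable_funM.
  - by apply: emeasurable_funD; exact: measurable_funeM.
  - move=> z _; rewrite -!EFinM -EFinD lee_fin.
    rewrite -[X in X * _]ger0_norm// -!normrM; apply: le_trans (ler_normD _ _).
    rewrite le_eqVlt; apply/orP; left; apply/eqP; congr `|_|.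
    by rewrite /f /g -/p' -/(A z) -/(B z); ring.
rewrite ge0_integralD//=; last 4 first.
- by move=> z _; rewrite mule_ge0// lee_fin.
- exact: measurable_funeM.
- by move=> z _; rewrite mule_ge0// lee_fin.
- exact: measurable_funeM.
rewrite EFinD !EFinM [(zeta%:E * _)%E]muleC !ge0_integralZl ?lee_fin//.
apply: leeD; apply: lee_wpmul2l; rewrite ?lee_fin//.
exact: zso (ltnW kK).
Qed.

End information_states_theory.

(** * From distances to weighted integrals, and almost sure properties of the observations *)

(** Pointwise [t e <= s e + M |t - s|] on [X], while off [X] all terms vanish almost everywhere. The
    additive form avoids subtracting integrals that may be infinite. *)
Lemma ge0_integral_mul_le d (T : measurableType d) (R : realType)
    (nu : {measure set T -> \bar R}) (X : set T) (s t e : T -> R) (M D : R) :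
  measurable_fun setT s -> measurable_fun setT t -> measurable_fun setT e ->
  (forall z, 0 <= s z) -> (forall z, 0 <= t z) -> (forall z, 0 <= e z) ->
  0 <= M -> (forall z, X z -> e z <= M) ->
  {ae nu, forall z, ~ X z -> s z = 0} -> {ae nu, forall z, ~ X z -> t z = 0} ->
  (\int[nu]_z `|t z - s z|%:E <= D%:E)%E ->
  (\int[nu]_z (t z * e z)%:E <= \int[nu]_z (s z * e z)%:E + M%:E * D%:E)%E.
Proof.
move=> ms mt me s0 t0 e0 M0 eM sX tX tsD.
have mts : measurable_fun setT (fun z => `|t z - s z|%:E).
  by apply/measurable_EFinP/measurableT_comp => //; exact: measurable_funB.
have mse : measurable_fun setT (fun z => (s z * e z)%:E).
  exact/measurable_EFinP/measurable_funM.
apply: (@le_trans _ _ (\int[nu]_z ((s z * e z)%:E + M%:E * `|t z - s z|%:E))%E).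
  apply: ae_ge0_le_integral => //.
  - by move=> z _; rewrite lee_fin mulr_ge0.
  - exact/measurable_EFinP/measurable_funM.
  - by move=> z _; rewrite -EFinM -EFinD lee_fin addr_ge0// mulr_ge0.
  - by apply: emeasurable_funD => //; exact: measurable_funeM.
  apply: filterS2 sX tX => z sX tX _; rewrite -EFinM -EFinD lee_fin.
  have [Xz|nX] := pselect (X z); last first.
    by rewrite sX// tX// !mul0r subrr normr0 mulr0 addr0.
  rewrite -lerBlDl -mulrBl (le_trans (ler_norm _))// normrM mulrC.
  by rewrite (ger0_norm (e0 z)) ler_wpM2r// eM.
rewrite ge0_integralD//; last 3 first.
- by move=> z _; rewrite lee_fin mulr_ge0.
- by move=> z _; rewrite mule_ge0// lee_fin.
- exact: measurable_funeM.
by rewrite ge0_integralZl//= leeD2l// lee_wpmul2l// lee_fin.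
Qed.

Lemma dtilde_ge0 (R : realType) (phi : R -> R) (phio : nat -> R -> R)
    (c zeta d0 : R) (K : nat) (y : nat -> R) :
  (forall t, 0 <= phi t) -> 0 <= c -> 0 <= zeta -> 0 <= d0 ->
  0 <= dtilde phi phio c zeta d0 K y.
Proof.
move=> phi0 c0 z0 d00; apply: addr_ge0.
  by rewrite !mulr_ge0 ?exprn_ge0// invr_ge0 prodr_ge0.
apply: sumr_ge0 => j _.
by rewrite !mulr_ge0 ?exprn_ge0// invr_ge0 prodr_ge0.
Qed.

Lemma measurable_dtilde d (T : measurableType d) (R : realType) (phi : R -> R)
    (phio : nat -> R -> R) (c zeta d0 : R) (K : nat) (y : nat -> T -> R) :
  measurable_fun [set: R] phi ->
  (forall i, (1 <= i <= K)%N -> measurable_fun [set: R] (phio i)) ->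
  (forall i, measurable_fun setT (y i)) ->
  measurable_fun setT (fun w => dtilde phi phio c zeta d0 K (y^~ w)).
Proof.
move=> mphi mphio my.
have mphiy i : measurable_fun setT (fun w => phi (y i w)).
  exact: (measurableT_comp mphi (my i)).
have mprod a : measurable_fun setT (fun w => \prod_(a <= i < K.+1) phi (y i w)).
  by apply: measurable_prod => i _; exact: mphiy.
apply: measurable_funD.
  by apply: measurable_funM => //; exact: measurable_funV.
(* The guard makes every summand measurable whatever its index, although [phio j] is known to be
   measurable only for [1 <= j <= K]. *)
rewrite [X in measurable_fun _ X](_ : _ = (fun w =>
  \sum_(j <- index_iota 1 K.+1)
    if (1 <= j <= K)%N then c ^+ (K - j).+1 * zeta /
      \prod_(j.+1 <= i < K.+1) phi (y i w) *
      `|(phio j (y j w))^-1 - (phi (y j w))^-1| else 0)); last first.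
  by apply/funext => w; apply: eq_big_nat => j; rewrite ltnS => ->.
apply: measurable_sum => j; case: (boolP (1 <= j <= K)%N) => // jK.
apply: measurable_funM.
  by apply: measurable_funM => //; exact: measurable_funV.
apply: measurableT_comp => //; apply: measurable_funB.
  exact/measurable_funV/(measurableT_comp (mphio j jK) (my j)).
exact: measurable_funV.
Qed.

(** The probability that [y] lands in the zero set of [phi] is the integral of [phi] over that set,
    which is 0. *)
Lemma ae_density_neq0 d (Omega : measurableType d) (R : realType)
    (P : probability Omega R) (y : {RV P >-> R}) (phi : R -> R) :
  measurable_fun [set: R] phi ->
  (forall B : set R, measurable B ->
     P (y @^-1` B) = (\int[lebesgue_measure]_(t in B) (phi t)%:E)%E) ->
  {ae P, forall w, phi (y w) != 0}.
Proof.
move=> mphi Py; have mB : measurable (phi @^-1` [set 0]).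
  by rewrite -[X in measurable X]setTI; apply: mphi.
exists (y @^-1` (phi @^-1` [set 0])); split.
- by rewrite -[X in measurable X]setTI; apply: measurable_funP.
- by rewrite Py//; apply: integral0_eq => t /= ->.
- by move=> w /= /negP; rewrite negbK => /eqP.
Qed.

(** * Comparison of the objectives *)

Theorem theorem2 (R : realType) (n m K : nat)
  (* state space, dynamics, observation map, costs, noise densities *)
  (X : set (n.-tuple R)) (U : nat -> set (m.-tuple R))
  (b : n.-tuple R -> m.-tuple R -> n.-tuple R) (h : n.-tuple R -> R)
  (mu : R) (L : n.-tuple R -> m.-tuple R -> R) (Phi : n.-tuple R -> R)
  (psi : n.-tuple R -> R) (phi : R -> R)
  (X_measurable : measurable X)
  (U_compact : forall k, (k < K)%N -> compact_Rn (U k))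
  (b_measurable : measurable_fun setT
     (fun p : n.-tuple R * m.-tuple R => b p.1 p.2))
  (h_measurable : measurable_fun setT h)
  (mu_gt0 : 0 < mu)
  (L_measurable : measurable_fun setT
     (fun p : n.-tuple R * m.-tuple R => L p.1 p.2))
  (Phi_measurable : measurable_fun setT Phi)
  (psi_pdf : is_pdf (lebesgueRn R n) psi)
  (phi_pdf : is_pdf (@lebesgue_measure R) phi)
  (* the states remain in X: b(x,u) + w belongs to X almost surely *)
  (X_states : forall k x u, (k < K)%N -> X x -> U k u ->
     (\int[lebesgueRn R n]_(w in [set w | X (tadd (b x u) w)]) (psi w)%:E
        = 1)%E)
  (* initial information states *)
  (sigma0 sigma0o : n.-tuple R -> R)
  (sigma0_pdf : is_pdf (lebesgueRn R n) sigma0)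
  (sigma0_X : {ae lebesgueRn R n, forall z, ~ X z -> sigma0 z = 0})
  (sigma0o_ge0 : forall z, 0 <= sigma0o z)
  (sigma0o_L1 : (lebesgueRn R n).-integrable setT (EFin \o sigma0o))
  (sigma0o_X : {ae lebesgueRn R n, forall z, ~ X z -> sigma0o z = 0})
  (* gaslighting efforts *)
  (phio : nat -> R -> R)
  (phio_pdf : forall k, (1 <= k <= K)%N ->
     is_pdf (@lebesgue_measure R) (phio k))
  (* reference measure, observations and controls *)
  (d : measure_display) (Omega : measurableType d) (P : probability Omega R)
  (y : nat -> {RV P >-> R})
  (y_iid : iid_with_density K y phi)
  (phio_neq0 : forall k, (1 <= k <= K)%N ->
     {ae P, forall w, phio k (y k w) != 0})
  (u : nat -> Omega -> m.-tuple R)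
  (u_measurable : forall k, (k < K)%N -> measurable_fun setT (u k))
  (u_U : forall k w, (k < K)%N -> U k (u k w))
  (* constants *)
  (phihat l ePhi zeta : R)
  (phihat_max : is_maximum (range phi) phihat)
  (l_max : is_maximum
     [set r | exists k x v,
        [/\ (k < K)%N, X x, U k v & r = expR (mu * L x v)]] l)
  (ePhi_max : is_maximum [set expR (mu * Phi x) | x in X] ePhi)
  (zeta_gt0 : 0 < zeta)
  (zeta_max : is_maximum
     (info_norms mu b h L psi phi K U (fun=> phi) sigma0 `|`
      info_norms mu b h L psi phi K U phio sigma0o) zeta%:E) :
  (objective mu P Phi (fun w =>
     info_state mu b h L psi phi phio sigma0o (u^~ w) (fun k => y k w) K)
   - objective mu P Phi (fun w =>
     info_state mu b h L psi phi (fun=> phi) sigma0 (u^~ w) (fun k => y k w) K)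
   <= ePhi%:E *
      'E_P[(fun w => dtilde phi phio (phihat * l) zeta
              (dist_L1 sigma0o sigma0) K (fun k => y k w))])%E.
Proof.
have [K0 [x0 [v0 [K0K Xx0 Uv0 l_def]]]] := l_max.1.
have l0 : 0 <= l by rewrite l_def expR_ge0.
have cost_le k x v : (k < K)%N -> X x -> U k v -> expR (mu * L x v) <= l.
  by move=> kK Xx Uv; apply: l_max.2; exists k, x, v.
have phi_le t : phi t <= phihat by apply: phihat_max.2; exists t.
have [mphi phi0 _] := phi_pdf.
have [ms0 s00 _] := sigma0_pdf.
have s0i : (lebesgueRn R n).-integrable setT (EFin \o sigma0).
  apply/integrableP; split; first exact/measurable_EFinP.
  under eq_integral do rewrite gee0_abs ?lee_fin//.
  by case: sigma0_pdf => _ _ /= ->; rewrite ltry.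
have /integrableP[/measurable_EFinP ms0o _] := sigma0o_L1.
have phihat0 : 0 <= phihat by exact: le_trans (phi0 0) (phi_le 0).
have c0 : 0 <= phihat * l by exact: mulr_ge0.
have M0 : 0 <= ePhi by case: ePhi_max => -[x _ <-] _; exact: expR_ge0.
have ePhi_le z : X z -> expR (mu * Phi z) <= ePhi.
  by move=> Xz; apply: ePhi_max.2; exists z.
have mePhi : measurable_fun setT (fun z => expR (mu * Phi z)).
  by apply: measurableT_comp => //; exact: measurable_funM.
have mphio i : (1 <= i <= K)%N -> measurable_fun [set: R] (phio i).
  by move=> /phio_pdf[].
have my i : measurable_fun setT (y i) by exact: measurable_funP.
pose So w := info_state mu b h L psi phi phio sigma0o (u^~ w) (y^~ w) K.
pose S w := info_state mu b h L psi phi (fun=> phi) sigma0 (u^~ w) (y^~ w) K.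
pose D w := dtilde phi phio (phihat * l) zeta (dist_L1 sigma0o sigma0) K (y^~ w).
have So0 w z : 0 <= So w z.
  rewrite /So; apply: info_state_ge0 => //.
  by move=> i /phio_pdf[_ phioi0 _]; exact: phioi0.
have S0 w z : 0 <= S w z.
  by rewrite /S; apply: info_state_ge0.
have mSo : measurable_fun setT (fun p => So p.1 p.2).
  exact: (measurable_info_state mu b_measurable h_measurable L_measurable
    psi_pdf phi_pdf ms0o mphio u_measurable my (leqnn K)).
have mS : measurable_fun setT (fun p => S p.1 p.2).
  exact: (measurable_info_state mu b_measurable h_measurable L_measurable
    psi_pdf phi_pdf ms0 (fun _ _ => mphi) u_measurable my (leqnn K)).
have D0 w : 0 <= D w.
  by apply: dtilde_ge0 => //; [exact: ltW|exact: Rintegral_ge0].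
have mD : measurable_fun setT D by exact: measurable_dtilde.
pose J (s : Omega -> n.-tuple R -> R) w :=
  (\int[lebesgueRn R n]_z (s w z * expR (mu * Phi z))%:E)%E.
have mJ (s : Omega -> n.-tuple R -> R) :
    measurable_fun setT (fun p => s p.1 p.2) -> (forall w z, 0 <= s w z) ->
    measurable_fun setT (J s).
  move=> ms sge0.
  apply: (measurable_fun_fubini_tonelli_F
    (fun p => (s p.1 p.2 * expR (mu * Phi p.2))%:E)).
    apply/measurable_EFinP/measurable_funM => //.
    exact: (measurableT_comp mePhi measurable_snd).
  by move=> p; rewrite lee_fin mulr_ge0 ?expR_ge0.
have J0 (s : Omega -> n.-tuple R -> R) : (forall w z, 0 <= s w z) ->
    forall w, (0 <= J s w)%E.
  move=> sge0 w; apply: integral_ge0 => z _.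
  by rewrite lee_fin mulr_ge0 ?expR_ge0.
(* [zeta] bounds norms only along observations at which no denominator vanishes. This is the almost
   sure event on which it may be used. *)
have ae_neq0 : {ae P, forall w, forall i, (1 <= i <= K)%N ->
    phi (y i w) != 0 /\ phio i (y i w) != 0}.
  apply: ae_foralln => i; have [iK|niK] := boolP (1 <= i <= K)%N; last exact: aeW.
  have := @ae_density_neq0 _ _ _ P (y i) phi mphi (fun B mB => y_iid.1 i B iK mB).
  by apply: filterS2 (phio_neq0 i iK) => w h1 h2 _; split.
(* For a fixed outcome the controls and observations are deterministic admissible sequences, so the
   distance bound applies pathwise. *)
have ae_le : {ae P, forall w, setT w -> (J So w <= J S w + ePhi%:E * (D w)%:E)%E}.
  apply: filterS ae_neq0 => w yw _.
  have Uu i : (i < K)%N -> U i (u i w) by exact: u_U.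
  have zS k : (k <= K)%N -> (norm_L1 (info_state mu b h L psi phi (fun=> phi)
      sigma0 (u^~ w) (y^~ w) k) <= zeta%:E)%E.
    move=> kK; apply: zeta_max.2; left; exists k, (u^~ w), (y^~ w); split => //.
      by move=> i ik; apply: Uu; exact: leq_trans kK.
    by move=> i /andP[i1 ik]; have [] := yw i; rewrite ?i1 ?(leq_trans ik kK).
  have zSo k : (k <= K)%N -> (norm_L1 (info_state mu b h L psi phi phio
      sigma0o (u^~ w) (y^~ w) k) <= zeta%:E)%E.
    move=> kK; apply: zeta_max.2; right; exists k, (u^~ w), (y^~ w); split => //.
      by move=> i ik; apply: Uu; exact: leq_trans kK.
    by move=> i /andP[i1 ik]; have [] := yw i; rewrite ?i1 ?(leq_trans ik kK).
  apply: (ge0_integral_mul_le (X := X)) => //.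
  - exact: (measurableT_comp mS (measurable_pair1 w)).
  - exact: (measurableT_comp mSo (measurable_pair1 w)).
  - exact: (info_state_eq0 mu b_measurable h_measurable L_measurable psi_pdf
      phi_pdf X_measurable X_states (y^~ w) ms0 (fun _ _ => mphi) Uu sigma0_X
      (leqnn K)).
  - exact: (info_state_eq0 mu b_measurable h_measurable L_measurable psi_pdf
      phi_pdf X_measurable X_states (y^~ w) ms0o mphio Uu sigma0o_X
      (leqnn K)).
  - exact: (dist_info_state_le b_measurable h_measurable L_measurable psi_pdf
      phi_pdf X_measurable X_states phi_le l0 cost_le mphio Uu s0i sigma0_X
      sigma0o_L1 sigma0o_X zS zSo (leqnn K)).
have mED : measurable_fun setT (EFin \o D) by exact/measurable_EFinP.
have E0 : (0 <= \int[P]_w (EFin \o D) w)%E.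
  by apply: integral_ge0 => w _; rewrite lee_fin.
have JJ : (\int[P]_w J So w <= \int[P]_w J S w + ePhi%:E * \int[P]_w (EFin \o D) w)%E.
  rewrite -ge0_integralZl//; last by move=> w _; rewrite lee_fin.
  rewrite -ge0_integralD//; last 4 first.
  - by move=> w _; exact: J0.
  - exact: mJ.
  - by move=> w _; rewrite mule_ge0// lee_fin.
  - exact: measurable_funeM.
  apply: ae_ge0_le_integral => //.
  - by move=> w _; exact: J0.
  - exact: mJ.
  - by move=> w _; rewrite adde_ge0 ?J0// mule_ge0// lee_fin.
  - by apply: emeasurable_funD; [exact: mJ|exact: measurable_funeM].
rewrite unlock /objective -/(J So) -/(J S).
have JS0 : (0 <= \int[P]_w J S w)%E by apply: integral_ge0 => w _; exact: J0.
(* The additive inequality [JJ] turns into a bound on the difference directly when the original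
   objective is finite; the infinite case is settled by the conventions of extended arithmetic. *)
have [JSfin|] := boolP (\int[P]_w J S w \is a fin_num)%E.
  by rewrite leeBlDl.
rewrite ge0_fin_numE// -leNgt leye_eq => /eqP JSoo.
(* [x - +oo = -oo] for every [x], including [x = +oo]. *)
by rewrite [X in (_ - X)%E]JSoo /= addeNy leNye.
Qed.
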